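(* Let $\lambda$ be an uncountable cardinal and let $F$ be a field. Then there exists an $F$-algebra $R$ such that for any regular uncountable cardinal $\kappa \leq \lambda$ and any $i \in B(\kappa)$ there is a strongly uniform right $R$-module $L$ (of dimension $\kappa$) such that $\mathrm{End}_R(L) = F$ and $\Gamma(L) = i$. In particular, for every regular uncountable cardinal $\kappa\le\lambda$, the $\kappa$-spectrum $\mathrm{Spec}_\Gamma(\kappa,R)$ is full.
   Context: Rings are associative with unit; modules are unitary right modules. $\mathrm{End}_R(L)=F$ means that the $R$-endomorphisms of $L$ are exactly the multiplications by scalars of $F$. For a regular uncountable cardinal $\kappa$, $B(\kappa)$ is the Boolean algebra of all subsets of $\kappa$ modulo the club filter: for $E\subseteq\kappa$, $\bar E=\overline{E}$ is the class of all $D\subseteq\kappa$ with $D\cap C=E\cap C$ for some closed unbounded $C\subseteq\kappa$. Let $U$ be a module. A c.d.c. of length $\kappa$ ($\kappa$ an ordinal) in $U$ is a sequence $\mathcal U=(U_\alpha\mid\alpha<\kappa)$ of non-zero submodules of $U$ that is continuous ($U_0=U$, and $U_\alpha=\bigcap_{\beta<\alpha}U_\beta$ for limit $\alpha<\kappa$), strictly decreasing ($U_{\alpha+1}\subsetneq U_\alpha$), and cofinal (each non-zero submodule of $U$ contains some $U_\alpha$). $U$ is strongly uniform if there is a c.d.c. in $U$; the dimension of $U$ is the least length of a c.d.c. in $U$. For submodules $0\ne V\subsetneq W\subseteq U$, $W$ is complemented over $V$ (in $U$) if there is a submodule $X\subseteq U$ with $W\cap X=V$ and $W+X=U$. If $U$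 is strongly uniform of dimension $\kappa$, a regular uncountable cardinal, and $\mathcal U=(U_\alpha\mid\alpha<\kappa)$ is a c.d.c. in $U$, put $$E_{\mathcal U}=\{\alpha<\kappa\mid \exists\beta:\ \alpha<\beta<\kappa \text{ and } U_\alpha \text{ is not complemented over } U_\beta\}$$ and $\Gamma(U)=\overline{E_{\mathcal U}}\in B(\kappa)$; this does not depend on the choice of $\mathcal U$ (known fact). $\mathrm{Spec}_\Gamma(\kappa,R)$ is the set of all $i\in B(\kappa)$ such that $i=\Gamma(U)$ for some strongly uniform right $R$-module $U$ of dimension $\kappa$; it is full if it equals $B(\kappa)$. *)

(* Defs.v *)
From HB Require Import structures.
From mathcomp Require Import all_boot all_order all_algebra.
From mathcomp Require Import wochoice all_classical.

Set Implicit Arguments.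
Unset Strict Implicit.
Unset Printing Implicit Defensive.

Import Order.TTheory GRing.Theory.

Local Open Scope classical_set_scope.
Local Open Scope card_scope.
Local Open Scope order_scope.
Local Open Scope ring_scope.

(* Ordinals are well-ordered types, taken up to isomorphism. *)
Section Ordinals.
Context {d : Order.disp_t} (K : orderType d).
Implicit Types (a b c : K) (C D E A : set K).

Definition is_ordinal := well_order (<=%O : rel K).

(* order type of K <= order type of K': K is isomorphic to an initial segment
   of K' *)
Definition ordinal_le {d'} (K' : orderType d') :=
  exists f : K -> K', {mono f : a b / (a <= b)%O} /\
    forall a (b : K'), (b <= f a)%O -> exists c, f c = b.

(* initial ordinals; this includes the finite ones *)
Definition is_cardinal :=
  is_ordinal /\ forall a, ~ ([set: K] #<= [set b | (b < a)%O]).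

Definition uncountable_cardinal := is_cardinal /\ ~ countable [set: K].

Definition unbounded A := forall a, exists2 b, A b & (a < b)%O.

(* For an infinite cardinal: the cofinality of K is K. *)
Definition regular_uncountable :=
  uncountable_cardinal /\ forall A, unbounded A -> [set: K] #<= A.

Definition is_zero a := forall b, (a <= b)%O.

Definition is_succ a b := (a < b)%O /\ forall c, (a < c)%O -> (b <= c)%O.

Definition is_limit a :=
  ~ is_zero a /\ forall b, (b < a)%O -> exists c, (b < c < a)%O.

Definition club C :=
  unbounded C /\
  forall a, is_limit a ->
    (forall b, (b < a)%O -> exists2 c, C c & (b < c < a)%O) -> C a.

Definition club_class E : set (set K) :=
  [set D | exists2 C, club C & D `&` C = E `&` C].

(* B(kappa), as the set of classes of subsets of kappa modulo the club filter *)
Definition Bclub : set (set (set K)) := range club_class.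

End Ordinals.

Arguments is_ordinal {d} K.
Arguments ordinal_le {d} K {d'} K'.
Arguments is_cardinal {d} K.
Arguments uncountable_cardinal {d} K.
Arguments regular_uncountable {d} K.
Arguments Bclub {d} K.

(* Right R-modules are left modules over the converse ring R^c. *)
Section Modules.
Context {R : nzRingType} (L : lmodType R).
Implicit Types V W X : set L.

Definition submodule V := submod_closed (mem V).

Definition nz_submodule V := submodule V /\ V <> [set 0].

Definition complemented_over W V :=
  exists X, [/\ submodule X, W `&` X = V & [set w + x | w in W & x in X] = setT].

Definition is_cdc {d} (K : orderType d) (U : K -> set L) :=
  [/\ forall a, nz_submodule (U a),
      exists2 a, is_zero a & U a = setT,
      forall a, is_limit a -> U a = \bigcap_(b in [set b | (b < a)%O]) U b,
      forall a b, is_succ a b -> U b `<` U a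
    & forall V, nz_submodule V -> exists a, U a `<=` V].

Definition strongly_uniform :=
  exists d (K : orderType d), is_ordinal K /\ exists U : K -> set L, is_cdc U.

Definition has_dimension {d} (K : orderType d) :=
  [/\ is_ordinal K,
      exists U : K -> set L, is_cdc U
    & forall d' (K' : orderType d'), is_ordinal K' ->
        (exists U : K' -> set L, is_cdc U) -> ordinal_le K K'].

Definition non_complemented {d} (K : orderType d) (U : K -> set L) : set K :=
  [set a | exists b, (a < b)%O /\ ~ complemented_over (U a) (U b)].

(* Meaningful for L of dimension K, a regular uncountable cardinal; the class
   then does not depend on the c.d.c. chosen by xget. *)
Definition Gamma {d} (K : orderType d) : set (set K) :=
  club_class (non_complemented (xget (fun=> setT) [set U : K -> set L | is_cdc U])).

End Modules.

Arguments has_dimension {R} L {d} K.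
Arguments Gamma {R} L {d} K.

Section Algebras.
Context {F : fieldType} (R : algType F).

(* The endomorphisms of the right R-module L are exactly the multiplications
   by scalars of F, where c in F acts through c%:A in R. *)
Definition End_eq_scalars (L : lmodType R^c) :=
  forall f : L -> L, linear f <-> exists c : F, forall x, f x = ((c%:A : R) : R^c) *: x.

Definition Spec_Gamma {d} (K : orderType d) : set (set (set K)) :=
  [set i | Bclub K i /\ exists L : lmodType R^c,
     [/\ strongly_uniform L, has_dimension L K & Gamma L K = i]].

Definition full_spectrum {d} (K : orderType d) := @Spec_Gamma d K = Bclub K.

End Algebras.

Arguments Spec_Gamma {F} R {d} K.
Arguments full_spectrum {F} R {d} K.

(* Main.v *)
Require Import Defs.
From HB Require Import structures.
From mathcomp Require Import all_boot all_order all_algebra.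
From mathcomp Require Import wochoice all_classical.

(** Let W be the space of functions from finite sequences in lambda to F.  A
    lambda-indexed family of vectors of W is a function on nonempty sequences,
    hence again a vector of W: the coordinate of x at g is s |-> x (g :: s), and
    the family of the coordinates of x below g can itself be used as a
    coordinate.  Embed kappa in lambda.  The module L consists of the x
    supported on kappa which are coherent from some a < kappa on: for b >= a,
    the coordinate at b is the family of the coordinates below b.  So x is
    determined by its coordinates below a, these are arbitrary, and all later
    coordinates are non-zero unless x = 0.

    Let U_a be the set of x in L vanishing below a, and X_ab the set of x in L
    vanishing on [a, b).  Then X_ab meets U_a in U_b, and U_a + X_ab = L.  Let R
    act on L through all linear maps which preserve L, the U_a, and the X_ab
    for a outside E.  Any map acting coordinatewise below a extends coherently
    to L, so there are enough endomorphisms for each non-zero x to generate some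
    U_a and for only scalars to commute with R.  If a is non-zero and in E, a
    functional on germs at a gives an endomorphism from the coordinates below a
    to the coordinate at a, which preserves X_cd for c <> a but is incompatible
    with a complement of U_a over any U_b.

    To serve all kappa and E at once, R is the product, over all families p of
    subspaces of W, of the algebras of linear maps stabilizing p. *)

Set Implicit Arguments.
Unset Strict Implicit.
Unset Printing Implicit Defensive.

Import Order.TTheory GRing.Theory.

Local Open Scope classical_set_scope.
Local Open Scope card_scope.
Local Open Scope ring_scope.

(** * Algebras of stabilizers of families of subspaces *)

Section Submodules.
Context {R : nzRingType} {L : lmodType R}.

Lemma linear_fun0 (L' : lmodType R) (f : L -> L') : linear f -> f 0 = 0.
Proof. by move=> lf; have := lf (-1) 0 0; rewrite scaler0 addr0 scaleN1r addNr. Qed.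

Lemma submoduleP (V : set L) :
  submodule V <-> V 0 /\ forall a x y, V x -> V y -> V (a *: x + y).
Proof.
split=> [[V0 sV]|[V0 sV]]; split.
- by rewrite inE in V0.
- by move=> a x y Vx Vy; have := @sV a x y; rewrite !inE; apply.
- by rewrite inE.
- by move=> a x y; rewrite !inE; exact: sV.
Qed.

(** If [X] complements [W] over [V'], then [V + X] does so over [V]: by the modular law [W] meets it
    in [V + V'], which is [V]. *)
Lemma complemented_overS (W V V' : set L) : submodule W -> submodule V ->
  V' `<=` V -> V `<=` W -> complemented_over W V' -> complemented_over W V.
Proof.
move=> /submoduleP[_ sW] /submoduleP[V0 sV] V'V VW [X [/submoduleP[X0 sX] WX WXT]].
exists [set v + x | v in V & x in X]; split.
- apply/submoduleP; split; first by exists 0 => //; exists 0; rewrite ?addr0.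
  move=> a _ _ [v Vv [x Xx <-]] [v' Vv' [x' Xx' <-]].
  exists (a *: v + v'); first exact: sV.
  by exists (a *: x + x'); [exact: sX|rewrite scalerDr addrACA].
- apply/seteqP; split=> [z [Wz [v Vv [x Xx zE]]]|v Vv]; last first.
    by split; [exact: VW|exists v => //; exists 0; rewrite ?addr0].
  have : V x.
    apply: V'V; rewrite -WX; split=> //.
    have -> : x = -1 *: v + z by rewrite -zE scaleN1r addKr.
    by apply: sW => //; exact: VW.
  by move=> Vx; have := sV 1 v x Vv Vx; rewrite scale1r zE.
- apply/seteqP; split=> // z _; have : [set w + x | w in W & x in X] z by rewrite WXT.
  move=> [w Ww [x Xx <-]]; exists w => //; exists x => //.
  by exists 0 => //; exists x; rewrite ?add0r.
Qed.

Lemma submoduleI (V1 V2 : set L) : submodule V1 -> submodule V2 -> submodule (V1 `&` V2).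
Proof.
move=> /submoduleP[V10 sV1] /submoduleP[V20 sV2]; apply/submoduleP.
by split=> // k x y [x1 x2] [y1 y2]; split; [exact: sV1|exact: sV2].
Qed.

End Submodules.

Section StabilizerAlgebra.
Context {F : fieldType} {W : lmodType F}.
Implicit Types (p : set (set W)) (X : set W).

(** Members of [p] that are not subspaces impose no condition. This keeps the stabilizing maps
    closed under linear combinations for an arbitrary set [p]. *)
Definition stabilizes p (f : W -> W) :=
  linear f /\ forall X, p X -> submodule X -> forall x, X x -> X (f x).

Definition stab_pred : {pred set (set W) -> W -> W} :=
  fun r => `[< forall p, stabilizes p (r p) >].

Lemma stab_predP r : reflect (forall p, stabilizes p (r p)) (r \in stab_pred).
Proof. exact: asboolP. Qed.

Lemma stab_submod_closed : submod_closed stab_pred.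
Proof.
split=> [|a r s /stab_predP hr /stab_predP hs].
  apply/stab_predP => p; split=> [a x y|X _ X0 x _].
    by rewrite scaler0 addr0.
  by case: X0 => + _; rewrite !inE.
apply/stab_predP => p; have [[lr sr] [ls ss]] := (hr p, hs p).
have E x : (a *: r + s) p x = a *: r p x + s p x by [].
split=> [b x y|X pX sX x Xx].
  rewrite !E lr ls !scalerDr !scalerA [a * b]mulrC -!addrA; congr (_ + _).
  by rewrite addrCA.
case: (sX) => _ /(_ a (r p x) (s p x)); rewrite E !inE; apply.
  exact: sr Xx.
exact: ss Xx.
Qed.

HB.instance Definition _ :=
  GRing.isSubmodClosed.Build F (set (set W) -> W -> W) stab_pred
    (GRing.submod_closed_semi stab_submod_closed).

End StabilizerAlgebra.

Section StabilizerRing.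
Context {F : fieldType} {W : lmodType F} {nzW : exists w : W, w != 0}.
Implicit Types (p : set (set W)) (X : set W).

(** The witness [nz] is a parameter of the type, so that the ring instance can use it to prove that
    1 differs from 0. *)
Record stab_algebra (nz : exists w : W, w != 0) := StabAlg {
  stab_fun :> set (set W) -> W -> W;
  _ : stab_fun \in stab_pred }.

HB.instance Definition _ := [isSub for @stab_fun nzW].
HB.instance Definition _ := [Choice of stab_algebra nzW by <:].
HB.instance Definition _ := [SubChoice_isSubZmodule of stab_algebra nzW by <:].
HB.instance Definition _ := [SubZmodule_isSubLmodule of stab_algebra nzW by <:].

Implicit Types r s : stab_algebra nzW.

Lemma stab_funP r p : stabilizes p (r p).
Proof. by case: r => r /= /stab_predP. Qed.

Lemma stab_eqP r s : (forall p x, r p x = s p x) -> r = s.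
Proof. by move=> rs; apply/val_inj/funext => p; apply/funext => x; exact: rs. Qed.

Lemma stabilizes_id p : stabilizes p idfun.
Proof. by []. Qed.

Lemma stabilizes_comp p f g :
  stabilizes p f -> stabilizes p g -> stabilizes p (g \o f).
Proof.
move=> [lf sf] [lg sg]; split=> [a x y|X pX sX x Xx] /=; first by rewrite lf lg.
exact/(sg _ pX)/(sf _ pX).
Qed.

Definition stab_one : stab_algebra nzW :=
  StabAlg nzW (introT (stab_predP _) stabilizes_id).

(* The action is on the right, hence the order of composition. *)
Definition stab_mul r s : stab_algebra nzW :=
  StabAlg nzW (introT (stab_predP (fun p => s p \o r p))
  (fun p => stabilizes_comp (stab_funP r p) (stab_funP s p))).

Lemma stab_mulA : associative stab_mul. Proof. by move=> r s t; exact: stab_eqP. Qed.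
Lemma stab_mul1r : left_id stab_one stab_mul. Proof. by move=> r; exact: stab_eqP. Qed.
Lemma stab_mulr1 : right_id stab_one stab_mul. Proof. by move=> r; exact: stab_eqP. Qed.
Lemma stab_mulDl : left_distributive stab_mul +%R.
Proof.
move=> r s t; apply: stab_eqP => p x /=; have [lt _] := stab_funP t p.
by have := lt 1 (r p x) (s p x); rewrite !scale1r.
Qed.
Lemma stab_mulDr : right_distributive stab_mul +%R.
Proof. by move=> r s t; apply: stab_eqP. Qed.
Lemma stab_1neq0 : stab_one != 0.
Proof.
case: nzW => w w0; apply/eqP => /(congr1 (fun r : (stab_algebra nzW) => r set0 w)) /= e.
by rewrite e eqxx in w0.
Qed.

HB.instance Definition _ := GRing.Zmodule_isNzRing.Build (stab_algebra nzW)
  stab_mulA stab_mul1r stab_mulr1 stab_mulDl stab_mulDr stab_1neq0.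

Lemma stab_scaleAl a r s : a *: (r * s) = (a *: r) * s.
Proof.
apply: stab_eqP => p x /=; have [ls _] := stab_funP s p.
by have := ls a (r p x) 0; rewrite (linear_fun0 ls) !addr0.
Qed.
HB.instance Definition _ := GRing.Lmodule_isLalgebra.Build F (stab_algebra nzW) stab_scaleAl.
Lemma stab_scaleAr a r s : a *: (r * s) = r * (a *: s).
Proof. exact: stab_eqP. Qed.
HB.instance Definition _ := GRing.Lalgebra_isAlgebra.Build F (stab_algebra nzW) stab_scaleAr.

(** The components at different families are independent: take the identity at every family other
    than [p]. *)
Lemma exists_stab p f : stabilizes p f -> exists r, r p = f.
Proof.
move=> sf; have sr : (fun q => if `[< q = p >] then f else idfun) \in stab_pred.
  by apply/stab_predP => q; case: asboolP => [->|].
by exists (StabAlg nzW sr); rewrite /= asboolT.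
Qed.

End StabilizerRing.

Arguments stab_algebra {F W} nz.

(** * The module on a stabilized subspace *)

Section StabilizerModule.
Context {F : fieldType} {W : lmodType F} {nzW : exists w : W, w != 0}.
Context {p : set (set W)} {L : set W} {pL : p L} {sL : submodule L}.

(** The memberships are parameters of the type: [h] fixes the family [p] whose component acts, and
    [h'] gives the linear structure. *)
Record stab_module (nz : exists w : W, w != 0) (h : p L) (h' : submodule L) :=
  StabModule { stab_val :> W; _ : stab_val \in L }.

Definition stab_module_pred : {pred W} := mem L.

HB.instance Definition _ := GRing.isSubmodClosed.Build F W stab_module_pred
  (GRing.submod_closed_semi sL).

Notation M := (stab_module nzW pL sL).

HB.instance Definition _ := [isSub of M for @stab_val nzW pL sL].
HB.instance Definition _ := [Choice of M by <:].
HB.instance Definition _ := GRing.SubChoice_isSubZmodule.Build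
  W stab_module_pred M (GRing.zmodClosedP stab_module_pred).

Lemma stab_valP (x : M) : L x.
Proof. by case: x => x /=; rewrite inE. Qed.

Lemma stab_act_subproof (r : stab_algebra nzW) (x : M) : r p x \in L.
Proof.
by rewrite inE; have [_ /(_ L pL sL)] := stab_funP r p; apply; exact: stab_valP.
Qed.

Definition stab_act (r : (stab_algebra nzW)^c) (x : M) : M :=
  StabModule nzW pL sL (stab_act_subproof r x).

Lemma stab_actA r s x : stab_act r (stab_act s x) = stab_act (r * s) x.
Proof. exact: val_inj. Qed.
Lemma stab_act1 : left_id 1 stab_act.
Proof. by move=> x; exact: val_inj. Qed.
Lemma stab_actDr : right_distributive stab_act +%R.
Proof.
move=> r x y; apply: val_inj => /=; have [lr _] := stab_funP r p.
by have := lr 1 (x : W) (y : W); rewrite !scale1r.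
Qed.
Lemma stab_actDl x : {morph stab_act^~ x : r s / r + s}.
Proof. by move=> r s; exact: val_inj. Qed.

HB.instance Definition _ := GRing.Zmodule_isLmodule.Build
  (stab_algebra nzW)^c M stab_actA stab_act1 stab_actDr stab_actDl.

Lemma stab_val_act (r : (stab_algebra nzW)^c) (x : M) :
  (r *: x : M) = (r : stab_algebra nzW) p x :> W.
Proof. by []. Qed.
Lemma stab_val_inj (x y : M) : x = y :> W -> x = y. Proof. exact: val_inj. Qed.
Lemma stab_val_scalar (c : F) (x : M) :
  (((c%:A : stab_algebra nzW) : (stab_algebra nzW)^c) *: x : M) = c *: (x : W) :> W.
Proof. by []. Qed.

Lemma stab_submodule (V : set W) : p V -> submodule V -> submodule [set x : M | V x].
Proof.
move=> pV sV; have /submoduleP[V0 VD] := sV; apply/submoduleP; split=> // r x y /= Vx Vy.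
have [_ /(_ V pV sV x Vx) Vrx] := stab_funP r p.
by have := VD 1 _ _ Vrx Vy; rewrite scale1r.
Qed.

End StabilizerModule.

(** * Well-orders and clubs *)

Section WellOrders.
Context {d : Order.disp_t} {K : orderType d} (woK : is_ordinal K).
Implicit Types (a b c : K) (A : set K).

Lemma well_order_min A : A !=set0 -> exists2 m, A m & forall x, A x -> (m <= x)%O.
Proof.
move=> [x Ax]; have [|m [[mA mlow] _]] := woK (A := mem A).
  by exists x; rewrite inE.
exists m; first by rewrite inE in mA.
by move=> y Ay; apply: mlow; rewrite inE.
Qed.

Lemma well_order_ind (P : K -> Prop) :
  (forall a, (forall b, (b < a)%O -> P b) -> P a) -> forall a, P a.
Proof.
move=> ih a; apply: contrapT => nPa.
have [|m nPm mlow] := @well_order_min [set b | ~ P b]; first by exists a.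
apply: nPm; apply: ih => b bm; apply: contrapT => nPb.
by have := mlow b nPb; rewrite leNgt bm.
Qed.

Lemma well_order_zero : [set: K] !=set0 -> exists a, is_zero a.
Proof. by move=> /well_order_min[m _ mlow]; exists m => b; exact: mlow. Qed.

Lemma is_succ_exists a b : (a < b)%O -> exists c, is_succ a c.
Proof.
move=> ab; have [|c ac cmin] := @well_order_min [set c | (a < c)%O]; first by exists b.
by exists c.
Qed.

Lemma zero_succ_limit a : [\/ is_zero a, exists b, is_succ b a | is_limit a].
Proof.
have [a0|na0] := pselect (is_zero a); first by apply: Or31.
have [?|nS] := pselect (exists b, is_succ b a); first by apply: Or32.
apply: Or33; split=> // b ba; apply: contrapT => nc; apply: nS; exists b; split=> // c bc.
by rewrite leNgt; apply/negP => ca; apply: nc; exists c; rewrite bc.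
Qed.

End WellOrders.

Section Regular.
Context {d : Order.disp_t} {K : orderType d} (regK : regular_uncountable K).
Implicit Types (a b c : K) (A : set K).

Let cardK : is_cardinal K. Proof. by case: regK => -[]. Qed.
Let woK : is_ordinal K. Proof. by case: cardK. Qed.

Lemma regular_nonempty : [set: K] !=set0.
Proof.
case: regK => -[_ unc] _; apply/set0P/eqP => K0.
by apply: unc; rewrite K0; exact: countable0.
Qed.

(** By regularity an unbounded set is as large as [K], which is uncountable. *)
Lemma countable_bounded A : countable A -> exists a, forall b, A b -> (b <= a)%O.
Proof.
move=> cA; have [[_ unc] reg] := regK; apply: contrapT => nb; apply: unc.
apply: sub_countable (reg A _) cA => a; apply: contrapT => na; apply: nb; exists a => b Ab.
by rewrite leNgt; apply/negP => ab; apply: na; exists b.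
Qed.

(* Hilbert's hotel *)
Lemma infinite_card_le_setD1 (T : Type) (x : T) :
  infinite_set [set: T] -> [set: T] #<= [set y | y <> x].
Proof.
elim/Ppointed: T x => T x; first by have := no x.
move=> infT; have : infinite_set ([set: T] `\` [set x]).
  by apply: infinite_setD => //; exact: finite_set1.
move=> /infiniteP/pcard_leP[u].
have uinj m n : u m = u n -> m = n by apply: inj; rewrite inE.
have ux n : u n <> x by have [] : ([set: T] `\` [set x]) (u n) by exact: funS.
pose g y := if pselect (y = x) then u 0%N else
  if pselect (exists n, y = u n) is left h then u (projT1 (cid h)).+1 else y.
have gx : g x = u 0%N by rewrite /g; case: pselect.
have gu n : g (u n) = u n.+1.
  rewrite /g; case: pselect => [/ux//|ne] /=; case: pselect => [h|[]]; last by exists n.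
  by case: cid => m /= /uinj <-.
have gy y : y <> x -> (forall n, y <> u n) -> g y = y.
  move=> yx yu; rewrite /g; case: pselect => //= ne; case: pselect => //= h.
  by exfalso; case: h => n /yu.
have cases y : [\/ y = x, exists n, y = u n | y <> x /\ forall n, y <> u n].
  have [->|yx] := pselect (y = x); first exact: Or31.
  have [|yu] := pselect (exists n, y = u n); first exact: Or32.
  by apply: Or33; split=> // n e; apply: yu; exists n.
apply/pcard_leP/injfunPex; exists g.
  move=> y _ /=; have [->|[n ->]|[yx yu]] := cases y; rewrite ?gx ?gu ?gy//; exact: ux.
move=> y z _ _.
have [->|[n ->]|[yx yu]] := cases y; have [->|[m ->]|[zx zu]] := cases z;
  rewrite ?gx ?gu ?gy // => e.
- by have := uinj _ _ e.
- by case: (zu _ (esym e)).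
- by have := uinj _ _ e.
- by have [->] := uinj _ _ e.
- by case: (zu _ (esym e)).
- by case: (yu _ e).
- by case: (yu _ e).
Qed.

(** If [a] were the greatest element, Hilbert's hotel would inject [K] into the segment below [a],
    although [K] is an initial ordinal. *)
Lemma regular_unbounded a : exists b, (a < b)%O.
Proof.
have [[_ nc] _] := regK; apply: contrapT => nb.
have maxa b : (b <= a)%O by rewrite leNgt; apply/negP => ab; apply: nb; exists b.
case: cardK => _ /(_ a); apply.
rewrite (_ : [set b | _] = [set b | b <> a]).
  apply: infinite_card_le_setD1 => /finite_set_countable //; apply: nc.
apply/seteqP; split=> b /=; first by move=> ba /eqP; rewrite (lt_eqF ba).
by move=> /eqP ba; rewrite lt_neqAle ba maxa.
Qed.

Lemma regular_unbounded2 a b : exists2 c, (a < c)%O & (b < c)%O.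
Proof.
have [c] := regular_unbounded (Order.max a b).
by rewrite gt_max => /andP[ac bc]; exists c.
Qed.

(* The supremum of the sequence [a0 < a1 < ...] with [P a_n a_(n+1)] has
   countable cofinality, hence lies below [K]. *)
Lemma limit_of_step (P : K -> K -> Prop) a0 :
    (forall a, exists2 b, (a < b)%O & P a b) ->
  exists m, [/\ is_limit m, (a0 < m)%O &
    forall b, (b < m)%O -> exists c c', [/\ (b < c)%O, (c < c')%O, (c' < m)%O & P c c']].
Proof.
move=> step.
have /choice[s sP] : forall a, exists b, (a < b)%O /\ P a b.
  by move=> a; have [b] := step a; exists b.
pose u n := iter n s a0.
have uS n : (u n < u n.+1)%O by have [] := sP (u n).
have [|b0 ub0] := @countable_bounded (range u).
  exact: (card_le_trans (card_image_le _ _)).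
have [|m ubm mmin] := well_order_min woK (A := [set b | forall n, (u n <= b)%O]).
  by exists b0 => n; apply: ub0; exists n.
have um n : (u n < m)%O by apply: lt_le_trans (uS n) _.
have below b : (b < m)%O -> exists n, (b < u n)%O.
  move=> bm; apply: contrapT => nb; have : (m <= b)%O; last by rewrite leNgt bm.
  by apply: mmin => n; rewrite leNgt; apply/negP => bn; apply: nb; exists n.
exists m; split; last 2 first.
- exact: (um 0%N).
- move=> b /below[n bn]; exists (u n), (u n.+1); split=> //.
  by have [] := sP (u n).
split=> [m0|b /below[n bn]]; last by exists (u n); rewrite bn um.
by have := m0 a0; rewrite leNgt (um 0%N).
Qed.

Lemma clubI (C1 C2 : set K) : club C1 -> club C2 -> club (C1 `&` C2).
Proof.
move=> [unb1 cl1] [unb2 cl2]; split=> [a|a lima acc]; last first.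
  by split; [apply: cl1|apply: cl2] => // b /acc[c [C1c C2c] bca]; exists c.
(* Each step passes over an element of [C1] and one of [C2], so [m] is a limit of both clubs. *)
have [|m [limm am acc]] := @limit_of_step
    (fun a b => (exists2 c, C1 c & (a < c < b)%O) /\ exists2 c, C2 c & (a < c < b)%O) a.
  move=> b; have [c C1c bc] := unb1 b; have [c' C2c' bc'] := unb2 b.
  have [e ce c'e] := regular_unbounded2 c c'; exists e; first exact: lt_trans ce.
  by split; [exists c|exists c'] => //; apply/andP.
exists m => //; split; [apply: cl1 => //|apply: cl2 => //].
- move=> b /acc[c [c' [bc _ cm [[e Ce /andP[ce ec]] _]]]].
  by exists e => //; rewrite (lt_trans bc ce) (lt_trans ec cm).
- move=> b /acc[c [c' [bc _ cm [_ [e Ce /andP[ce ec]]]]]].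
  by exists e => //; rewrite (lt_trans bc ce) (lt_trans ec cm).
Qed.

Lemma club_nonzero : club [set a : K | ~ is_zero a].
Proof.
split=> [a|a [na0 _] _ //]; have [b ab] := regular_unbounded a.
by exists b => // /(_ a); rewrite leNgt ab.
Qed.

Lemma club_class_eq (C E E' : set K) :
  club C -> E `&` C = E' `&` C -> club_class E = club_class E'.
Proof.
have sub (A A' : set K) : club C -> A `&` C = A' `&` C -> club_class A `<=` club_class A'.
  move=> clC eAA' D [C' clC' eDA]; exists (C' `&` C); first exact: clubI.
  rewrite !meetEset in eDA *.
  by rewrite setIA eDA -setIA [C' `&` C]setIC setIA eAA' -setIA [C `&` C']setIC.
by move=> clC eE; apply/seteqP; split; apply: sub.
Qed.

End Regular.

(** * Comparison of c.d.c.'s *)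

Section DecreasingChains.
Context {R : nzRingType} {L : lmodType R}.
Context {d : Order.disp_t} {K : orderType d} (woK : is_ordinal K).
Implicit Types (a b c : K) (U V : K -> set L).

Lemma cdc_decr U a b : is_cdc U -> (a <= b)%O -> U b `<=` U a.
Proof.
move=> [_ _ Ulim Usucc _]; elim/(well_order_ind woK): b => b ih.
rewrite le_eqVlt => /predU1P[->//|ab].
have [b0|[c cb]|limb] := zero_succ_limit b.
- by have := b0 a; rewrite leNgt ab.
- have cltb : (c < b)%O by case: cb.
  apply: subset_trans (ih c cltb _); first by have [] := Usucc _ _ cb.
  by rewrite leNgt; apply/negP => /(proj2 cb); rewrite leNgt ab.
- by rewrite (Ulim b limb) => x; apply.
Qed.

Lemma cdc_strict U a b : is_cdc U -> (a < b)%O -> ~ (U a `<=` U b).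
Proof.
move=> Ucdc ab; have [c ac] := is_succ_exists woK ab.
case: (Ucdc) => _ _ _ /(_ _ _ ac)[_ nsub] _ sub; apply: nsub.
by apply: subset_trans sub _; apply: cdc_decr => //; case: ac => _; apply.
Qed.

End DecreasingChains.

(** * Dimension, and independence of Gamma from the chain *)

Section Dimension.
Context {R : nzRingType} {L : lmodType R}.
Context {d : Order.disp_t} {K : orderType d} (regK : regular_uncountable K).
Implicit Types (a c : K) (U V : K -> set L).

Let cardK : is_cardinal K. Proof. by case: regK => -[]. Qed.
Let woK : is_ordinal K. Proof. by case: cardK. Qed.

(* The embedding of [K] sends [a] to the least element above the images of the
   elements below [a]; it can only fail to exist if [K'] is the image of a
   proper initial segment of [K]. *)
Lemma initial_embedding d' (K' : orderType d') (g : K' -> K) :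
  is_ordinal K' -> unbounded (range g) -> ordinal_le K K'.
Proof.
move=> woK' unbg; have [a00 _] := regular_nonempty regK.
have [_ [b0 _ _] _] := unbg a00.
have wf : well_founded (fun a b : K => (a < b)%O).
  by move=> a; elim/(well_order_ind woK): a => a ih; constructor.
pose above (a : K) (h : forall c, (c < a)%O -> K') : set K' :=
  [set b | forall c (ca : (c < a)%O), (h c ca < b)%O].
(* [b0] is a default value for the case without upper bounds; [fP] treats the other case. *)
pose step (a : K) (h : forall c, (c < a)%O -> K') : K' :=
  xget b0 [set m | above a h m /\ forall b, above a h b -> (m <= b)%O].
pose f : K -> K' := Fix wf (fun _ => K') step.
have fE a : f a = step a (fun c _ => f c).
  rewrite /f Fix_eq // => c h h' hh'; congr step.
  by apply: functional_extensionality_dep => e; apply: functional_extensionality_dep.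
pose ub a := [set b | forall c, (c < a)%O -> (f c < b)%O].
have fP a : ub a !=set0 -> ub a (f a) /\ forall b, ub a b -> (f a <= b)%O.
  move=> /(well_order_min woK')[m ubm mmin]; rewrite fE /step.
  by apply: (@xgetPex _ b0 [set m | above a _ m /\ _]); exists m.
(* Minimality of the values of [f] makes the image of an initial segment downward closed. *)
have init a : (forall c, (c <= a)%O -> ub c !=set0) ->
    forall b, (b <= f a)%O -> exists2 c, (c <= a)%O & f c = b.
  elim/(well_order_ind woK): a => a ih ne b; rewrite le_eqVlt => /predU1P[->|bfa].
    by exists a.
  have [c ca bfc] : exists2 c, (c < a)%O & (b <= f c)%O.
    apply: contrapT => nc; have [_ /(_ b)] := fP a (ne a (lexx a)).
    rewrite leNgt bfa => /(_ _)/negP []// c ca; rewrite ltNge; apply/negP => bfc.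
    by apply: nc; exists c.
  have [|e ec <-] := ih c ca _ b bfc.
    by move=> e ec; apply: ne; apply: le_trans ec (ltW ca).
  by exists e => //; apply: le_trans ec (ltW ca).
(* Without an upper bound, the images of the elements below [a] would exhaust [K']. The unbounded
   set [range g], as large as [K], would then be an image of the segment below [a], although [K] is
   an initial ordinal. *)
have ne a : ub a !=set0.
  elim/(well_order_ind woK): a => a ih; apply: contrapT => ub0.
  case: cardK => _ /(_ a); apply; case: regK => _ /(_ _ unbg) /card_le_trans; apply.
  apply: card_le_trans (card_image_le (g \o f) [set c | (c < a)%O]).
  apply: subset_card_le => _ [b _ <-].
  have [c ca bfc] : exists2 c, (c < a)%O & (b <= f c)%O.
    apply: contrapT => nc; apply: ub0; exists b => c ca; rewrite ltNge; apply/negP => bfc.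
    by apply: nc; exists c.
  have [|e ec <-] := init c _ b bfc; first by move=> e ec; apply/ih/(le_lt_trans ec).
  by exists e => //=; apply: le_lt_trans ca.
exists f; split=> [|a b bfa].
  by apply: le_mono => a b ab; have [+ _] := fP b (ne b); apply.
by have [c _ <-] := init a (fun c _ => ne c) b bfa; exists c.
Qed.

(** For another c.d.c. [V], the map [g] picks an index with [U (g b)] inside [V b]. Since [V] is
    cofinal and [U] strictly decreasing, [g] is unbounded and [initial_embedding] applies. *)
Lemma cdc_has_dimension U : is_cdc U -> has_dimension L K.
Proof.
move=> Ucdc; split=> //; first by exists U.
move=> d' K' woK' [V Vcdc].
have [nzU _ _ _ cofU] := Ucdc; have [nzV _ _ _ cofV] := Vcdc.
have /choice[g gP] : forall b, exists a, U a `<=` V b by move=> b; exact: cofU.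
apply: (initial_embedding (g := g)) => // a.
have [a' aa'] := regular_unbounded regK a; have [b VbU] := cofV (U a') (nzU a').
exists (g b); first by exists b.
rewrite (lt_le_trans aa') // leNgt; apply/negP => gb.
by apply: (cdc_strict woK Ucdc gb); apply: subset_trans VbU.
Qed.

Lemma cdc_limit_sub U V a : is_cdc U -> is_cdc V -> is_limit a ->
    (forall b, (b < a)%O -> exists c c', [/\ (b <= c)%O, (c' <= a)%O & U c' `<=` V c]) ->
  U a `<=` V a.
Proof.
move=> Ucdc Vcdc lima acc; have [_ _ Vlim _ _] := Vcdc; rewrite (Vlim a lima) => x Uax b ba.
have [c [c' [bc c'a UV]]] := acc b ba; apply: (cdc_decr woK Vcdc bc).
by apply: UV; apply: cdc_decr Uax.
Qed.

(** By cofinality the two chains interleave, and at a limit of interleaving steps both have the same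
    intersection. Closure follows from continuity in the same way. *)
Lemma cdc_agree_club U V : is_cdc U -> is_cdc V -> club [set a | U a = V a].
Proof.
move=> Ucdc Vcdc; have [nzU _ _ _ cofU] := Ucdc; have [nzV _ _ _ cofV] := Vcdc.
split=> [a|a lima acc].
  have [|m [limm am acc]] :=
      limit_of_step regK (P := fun a b => V b `<=` U a /\ U b `<=` V a) a.
    move=> b; have [c Vc] := cofV _ (nzU b); have [c' Uc'] := cofU _ (nzV b).
    have [e ce c'e] := regular_unbounded2 regK c c'.
    have [e' ee' be'] := regular_unbounded2 regK e b.
    exists e' => //; split; [apply: subset_trans Vc|apply: subset_trans Uc'].
    - exact: cdc_decr (ltW (lt_trans ce ee')).
    - exact: cdc_decr (ltW (lt_trans c'e ee')).
  exists m => //=; apply/seteqP; split.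
  - apply: cdc_limit_sub => // b /acc[c [c' [bc _ c'm [_ UV]]]].
    by exists c, c'; split => //; exact: ltW.
  - apply: cdc_limit_sub => // b /acc[c [c' [bc _ c'm [VU _]]]].
    by exists c, c'; split => //; exact: ltW.
by apply/seteqP; split; apply: cdc_limit_sub => // b /acc[c /= UVc /andP[bc ca]];
  exists c, c; rewrite UVc; split; try exact: ltW.
Qed.

(** Any [V e] inside [U b] with [a < e] is a witness: a complement over [V e] would give one over
    [U b] by [complemented_overS]. *)
Lemma non_complemented_sub U V a : is_cdc U -> is_cdc V -> U a = V a ->
  non_complemented U a -> non_complemented V a.
Proof.
move=> Ucdc Vcdc UVa [b [ab nc]].
have [nzU _ _ _ _] := Ucdc; have [nzV _ _ _ cofV] := Vcdc.
have [c VcU] := cofV _ (nzU b); have [e ce ae] := regular_unbounded2 regK c a.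
exists e; split=> // cVa; apply: nc; rewrite UVa.
apply: complemented_overS cVa.
- by case: (nzV a).
- by case: (nzU b).
- by apply: subset_trans VcU; exact: cdc_decr (ltW ce).
- by rewrite -UVa; exact: cdc_decr (ltW ab).
Qed.

(** The chosen chain and [U] agree on a club, and there [non_complemented_sub] works in both
    directions. *)
Lemma Gamma_cdc U : is_cdc U -> Gamma L K = club_class (non_complemented U).
Proof.
move=> Ucdc; rewrite /Gamma; set V := xget _ _.
have Vcdc : is_cdc V by apply: (@xgetPex _ _ [set U | is_cdc U]); exists U.
apply: (club_class_eq regK (cdc_agree_club Vcdc Ucdc)).
apply/seteqP; split=> a [nca /= e]; split => //; last by apply: non_complemented_sub nca.
by apply: non_complemented_sub nca.
Qed.

End Dimension.

(** * Coherent functions *)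

(** A maximal subspace [M] containing [N] and avoiding [x0] is a hyperplane; [h y] is the multiple
    of [x0] congruent to [y] modulo [M]. *)
Lemma separating_functional (F : fieldType) (W : lmodType F) (N : set W) (x0 : W) :
  submodule N -> ~ N x0 ->
  exists h : W -> F, [/\ forall a x y, h (a *: x + y) = a * h x + h y,
    forall x, N x -> h x = 0 & h x0 = 1].
Proof.
move=> sN Nx0; have [N0 _] := (submoduleP N).1 sN.
(* Adjoining [N] inside the condition makes it hold for the union of the empty chain as well. *)
have [|A [[sM Mx0] maxA]] :=
    @Zorn_bigcup W [set A | submodule (A `|` N) /\ ~ (A `|` N) x0].
  move=> C subC totC; split; last first.
    by move=> [[A CA Ax0]|//]; have [_] := subC A CA; apply; left.
  apply/submoduleP; split=> [|a x y]; first by right.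
  have inA A : C A -> (A `|` N) x -> (A `|` N) y ->
      (\bigcup_(X in C) X `|` N) (a *: x + y).
    move=> CA Ax Ay; have [/submoduleP[_ /(_ a x y Ax Ay)[Axy|Nxy]] _] := subC A CA.
      by left; exists A.
    by right.
  move=> [[A CA Ax]|Nx] [[B CB By]|Ny].
  - by have [AB|BA] := totC A B CA CB;
      [apply: (inA B)|apply: (inA A)] => //; left => //; [exact: AB|exact: BA].
  - by apply: (inA A) => //; [left|right].
  - by apply: (inA B) => //; [right|left].
  - by right; move/submoduleP : sN => [_]; apply.
set M := A `|` N in sM Mx0; move/submoduleP : sM => [M0 sM].
have hyper y : exists c, M (y - c *: x0).
  have [My|nMy] := pselect (M y); first by exists 0; rewrite scale0r subr0.
  (* [B] is the span of [M] and [y]. By maximality it contains [x0], so [x0 - a *: y] is in [M] for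
     some [a], and [a] is invertible because [x0] is not in [M]. *)
  pose B := [set z | exists a, M (z - a *: y)].
  have MB z : M z -> B z by exists 0; rewrite scale0r subr0.
  have BN : B `|` N = B by apply/setUidPl => z Nz; apply: MB; right.
  have [a Ma] : B x0.
    apply: contrapT => nB; apply: (maxA B).
      split=> [z Az|BA]; first by apply: MB; left.
      by apply: nMy; left; apply: BA; exists 1; rewrite scale1r subrr.
    split; rewrite BN //; apply/submoduleP; split=> [|a u v [b Mb] [c Mc]].
      exact: MB.
    exists (a * b + c).
    rewrite (_ : _ - _ = a *: (u - b *: y) + (v - c *: y)); first exact: sM.
    by rewrite scalerDl opprD scalerBr scalerA addrACA.
  have [a0|a0] := eqVneq a 0; first by case: Mx0; rewrite a0 scale0r subr0 in Ma.
  exists a^-1; have := sM (- a^-1) _ 0 Ma M0.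
  by rewrite addr0 scalerBr scalerA mulNr mulVf // scaleNr scaleN1r opprK addrC.
have uniq y c c' : M (y - c *: x0) -> M (y - c' *: x0) -> c = c'.
  move=> Mc Mc'; apply: contrapT => /eqP cc'; apply: Mx0.
  have := sM (-1) _ _ Mc Mc'; rewrite scaleN1r opprB addrA addrNK -scalerBl => Mcc.
  have := sM (c - c')^-1 _ 0 Mcc M0; rewrite addr0 scalerA mulVf ?scale1r //.
  by rewrite subr_eq0.
have /choice[h hP] := hyper.
exists h; split=> [a x y|x Nx|].
- apply: (uniq (a *: x + y)) => //.
  rewrite (_ : _ - _ = a *: (x - h x *: x0) + (y - h y *: x0)); first exact: sM.
  by rewrite scalerDl opprD scalerBr scalerA addrACA.
- by apply: (uniq x) => //; rewrite scale0r subr0; right.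
- by apply: (uniq x0) => //; rewrite scale1r subrr.
Qed.

Section CoherentFunctions.
Context {F : fieldType} {d : Order.disp_t} {lambda : orderType d}.
Context {d' : Order.disp_t} {kappa : orderType d'} (phi : kappa -> lambda).
Context (phi_mono : {mono phi : a b / (a <= b)%O}).
Implicit Types (a b c : kappa) (g e : lambda) (s t : seq lambda).

Notation W := (seq lambda -> F^o).
Implicit Types (x y z : W) (f : W -> W).

Let phi_lt a b : (phi a < phi b)%O = (a < b)%O. Proof. exact: leW_mono. Qed.

Definition head_lt g s := if s is e :: _ then (e < g)%O else false.

Definition coord g x : W := fun s => x (g :: s).

(** The value at the empty sequence is 0, since a family of coordinates lives on the non-empty
    sequences. *)
Definition trunc g x : W := fun s => if head_lt g s then x s else 0.

(* The coordinate at [g] encodes the family of the coordinates below [g]. *)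
Definition coherent g x := forall s, coord g x s = trunc g x s.

Definition supported x := forall g s, ~ range phi g -> x (g :: s) = 0.

Definition coherents : set W := [set x | [/\ x [::] = 0, supported x &
  exists a, forall b, (a <= b)%O -> coherent (phi b) x]].

Definition vanishing (A : set kappa) : set W :=
  [set x | forall c s, A c -> x (phi c :: s) = 0].

Lemma linfunE (k : F) x y s : (k *: x + y) s = k * x s + y s :> F.
Proof. by []. Qed.

Lemma scalefunE (k : F) x s : (k *: x) s = k * x s :> F.
Proof. by []. Qed.

Lemma coherent0 g : coherent g 0.
Proof. by move=> s; rewrite /trunc; case: ifP. Qed.

Lemma coherent_lin g (k : F) x y :
  coherent g x -> coherent g y -> coherent g (k *: x + y).
Proof.
move=> cx cy s; rewrite /coord /trunc !linfunE; have := cx s; have := cy s.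
rewrite /coord /trunc => -> ->.
by case: ifP => // _; rewrite mulr0 addr0.
Qed.

Lemma coherents_submodule a : submodule coherents.
Proof.
apply/submoduleP; split=> [|k x y [x0 sx [b cx]] [y0 sy [c cy]]].
  by split=> //; exists a => b _; exact: coherent0.
split=> [|g s nIg|]; first by rewrite linfunE x0 y0 mulr0 addr0.
  by rewrite linfunE sx ?sy // mulr0 addr0.
exists (Order.max b c) => e; rewrite ge_max => /andP[be ce].
exact: coherent_lin (cx e be) (cy e ce).
Qed.

Lemma vanishing_submodule A : submodule (vanishing A).
Proof.
apply/submoduleP; split=> [//|k x y x0 y0 c s Ac].
by rewrite linfunE x0 // y0 // mulr0 addr0.
Qed.

(* The map acting as [f] on the coordinates below [g0] and, on coherent
   functions, commuting with [coord g = trunc g] from [g0] on. *)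
Fixpoint extend g0 f s x : F^o :=
  if s is g :: t then
    if (g < g0)%O then f x s
    else if `[< range phi g >] && head_lt g t then extend g0 f t (coord g x) else 0
  else 0.

(** This makes [extend] respect coherence: for [x] coherent at [g], the functions [coord g x] and
    [x] agree at the coordinates below [g]. *)
Definition causal f := forall g x y,
  (forall e s, (e <= g)%O -> x (e :: s) = y (e :: s)) ->
  forall s, f x (g :: s) = f y (g :: s).

Lemma extend_lt g0 f x g s : (g < g0)%O -> extend g0 f (g :: s) x = f x (g :: s).
Proof. by move=> /= ->. Qed.

Lemma extend_causal g0 f : causal f -> causal (fun x s => extend g0 f s x).
Proof.
move=> cf g x y xy s /=; case: ifP => _; first exact: cf.
case: ifP => // _; congr extend; apply/funext => t; exact: xy.
Qed.

Lemma extend_coherent g0 f x g : causal f -> (g0 <= g)%O -> range phi g ->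
  coherent g x -> coherent g (fun s => extend g0 f s x).
Proof.
move=> cf g0g Ig cx s; rewrite /coord /trunc /= ltNge g0g /= asboolT //=.
case: s => [//|e s]; case: (boolP (head_lt g (e :: s))) => // eg.
apply: extend_causal => // e' t e'e; rewrite [LHS]cx /trunc /=.
by rewrite (le_lt_trans e'e eg).
Qed.

Lemma extend_coherents a0 f x a : causal f -> (forall x, supported (f x)) ->
  (forall b, (a <= b)%O -> coherent (phi b) x) ->
  coherents (fun s => extend (phi a0) f s x).
Proof.
move=> cf sf cx; split=> //.
  move=> g s nIg /=; case: ifP => _; first exact: sf.
  by rewrite asboolF.
exists (Order.max a0 a) => b; rewrite ge_max => /andP[a0b ab].
by apply: extend_coherent; rewrite ?phi_mono //; exact: cx.
Qed.

Lemma extend_linear g0 f : linear f -> linear (fun x s => extend g0 f s x).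
Proof.
move=> lf k x y; apply/funext => s; rewrite linfunE.
elim: s x y => [|g s ih] x y /=; first by rewrite mulr0 addr0.
case: ifP => _; first by rewrite lf.
by case: ifP => _; [exact: (ih (coord g x) (coord g y)) | rewrite mulr0 addr0].
Qed.

Lemma extend_vanishing g0 f x g s : linear f -> (g0 <= g)%O ->
  (forall t, x (g :: t) = 0) -> extend g0 f (g :: s) x = 0.
Proof.
move=> lf g0g x0 /=; rewrite ltNge g0g /=; case: ifP => // _.
have -> : coord g x = 0 by apply/funext => t; exact: x0.
by have /(congr1 (fun u => u s)) := linear_fun0 (extend_linear g0 lf).
Qed.

(** By induction on the sequence: from [a0] on, coherence reduces the value at [g :: s] to the value
    at the shorter [s]. *)
Lemma coherent_eq a0 x y : x [::] = y [::] -> supported x -> supported y ->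
  (forall b, (a0 <= b)%O -> coherent (phi b) x) ->
  (forall b, (a0 <= b)%O -> coherent (phi b) y) ->
  (forall c s, (c < a0)%O -> x (phi c :: s) = y (phi c :: s)) -> x = y.
Proof.
move=> xy0 sx sy cx cy xy; apply/funext; elim=> [//|g s ih].
have [[b _ <-]|nIg] := pselect (range phi g); last by rewrite sx ?sy.
have [ba0|a0b] := ltP b a0; first exact: xy.
by rewrite [LHS](cx b a0b s) [RHS](cy b a0b s) /trunc ih.
Qed.

(** The coherent function with the coordinates of [y] below [a]: the constant map [y] is causal and
    0 is coherent, so [extend] produces it. *)
Definition prolong a y : W := fun s => extend (phi a) (fun _ => y) s 0.

Lemma prolongP a y : supported y -> [/\ coherents (prolong a y),
  forall b, (a <= b)%O -> coherent (phi b) (prolong a y) &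
  forall c s, (c < a)%O -> prolong a y (phi c :: s) = y (phi c :: s)].
Proof.
move=> sy; split.
- by apply: (@extend_coherents _ _ _ a) => // b _; exact: coherent0.
- move=> b ab; apply: extend_coherent; rewrite ?phi_mono //.
  exact: coherent0.
- by move=> c s ca; rewrite /prolong extend_lt // phi_lt.
Qed.

(** * Tails, their complements and the maps preserving them *)

Definition tail a : set W := coherents `&` vanishing [set c | (c < a)%O].

Definition tail_compl a b : set W :=
  coherents `&` vanishing [set c | (a <= c < b)%O].

Context (E : set kappa).

Definition coherent_family : set (set W) := [set V | [\/ V = coherents,
  exists a, V = tail a | exists a b, ~ E a /\ V = tail_compl a b]].

Definition local f := forall a b, ~ E a -> forall x, supported x ->
  vanishing [set c | (a <= c < b)%O] x -> vanishing [set c | (a <= c < b)%O] (f x).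

Lemma causal_vanishing f a x : linear f -> causal f -> supported x ->
  vanishing [set c | (c < a)%O] x -> vanishing [set c | (c < a)%O] (f x).
Proof.
move=> lf cf sx vx c s ca; rewrite (cf _ _ 0) ?linear_fun0 // => e t ec.
have [[c' _ c'e]|nIe] := pselect (range phi e); last by rewrite sx.
by rewrite -c'e vx //= (le_lt_trans _ ca) // -phi_mono c'e.
Qed.

(** Below [a0] the map acts as [f], which preserves tails by causality and their complements by
    [local]. From [a0] on, a zero coordinate goes to a zero coordinate. *)
Lemma extend_stabilizes a0 f : linear f -> causal f ->
  (forall x, supported (f x)) -> local f ->
  stabilizes coherent_family (fun x s => extend (phi a0) f s x).
Proof.
move=> lf cf sf locf; split; first exact: extend_linear.
have coh x : coherents x -> coherents (fun s => extend (phi a0) f s x).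
  by move=> [_ _ [a cx]]; exact: extend_coherents cx.
move=> V [->|[a ->]|[a [b [nEa ->]]]] _ x; first exact: coh.
- move=> [cx vx]; split=> [|c s ca]; first exact: coh.
  have [ca0|a0c] := ltP c a0; last first.
    by apply: extend_vanishing => // [|t]; rewrite ?phi_mono // vx.
  by rewrite extend_lt ?phi_lt //; apply: (causal_vanishing lf cf _ vx) => //; case: cx.
- move=> [cx vx]; split=> [|c s cab]; first exact: coh.
  have [ca0|a0c] := ltP c a0; last first.
    by apply: extend_vanishing => // [|t]; rewrite ?phi_mono // vx.
  by rewrite extend_lt ?phi_lt //; apply: (locf a b) => //; case: cx.
Qed.

(** Acts separately on each coordinate, by evaluating it at [t] and multiplying the coordinate of
    [u] by the result. Hence it preserves vanishing on any set. *)
Definition diagonal t u x : W :=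
  fun s => if s is g :: s' then x (g :: t) * u (g :: s') else 0.

Lemma diagonal_stabilizes a0 t u : supported u ->
  stabilizes coherent_family (fun x s => extend (phi a0) (diagonal t u) s x).
Proof.
move=> su; apply: extend_stabilizes.
- move=> k x y; apply/funext => -[|g s]; rewrite linfunE /=; first by rewrite mulr0 addr0.
  by rewrite linfunE mulrDl mulrA.
- by move=> g x y xy s /=; rewrite xy.
- by move=> x g s nIg /=; rewrite su // mulr0.
- by move=> a b _ x _ vx c s cab /=; rewrite vx // mul0r.
Qed.

Context (kappa_unbounded : forall a, exists b, (a < b)%O).

Lemma coherent_head g e x s : coherent g x -> (e < g)%O -> x (g :: e :: s) = x (e :: s).
Proof. by move=> cx eg; have := cx (e :: s); rewrite /coord /trunc /= eg. Qed.

(** By coherence a non-zero value of [x] at [phi c :: t] reappears in all late coordinates.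
    Evaluating there and rescaling by [v^-1] lets a diagonal map send [x] to any [u] that vanishes
    early enough. *)
Lemma tail_attained x : coherents x -> x <> 0 ->
  exists a, forall u, tail a u -> exists2 f, stabilizes coherent_family f & f x = u.
Proof.
move=> [x0 sx [a cx]] nx.
have [c [t xct]] : exists c t, x (phi c :: t) <> 0.
  apply: contrapT => nct; apply: nx; apply/funext => -[//|g t].
  have [[c _ <-]|/sx->//] := pselect (range phi g).
  by apply: contrapT => xct; apply: nct; exists c, t.
set v := x (phi c :: t) in xct.
have [a1 a1P] := kappa_unbounded (Order.max a c).
move: a1P; rewrite gt_max => /andP[aa1 ca1].
exists a1 => u [[u0 su [a2 cu]] vu].
(* From [a3] on both [x] and [u] are coherent, so it suffices to compare the image of [x] with [u]
   below [a3]. *)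
pose a3 := Order.max a1 a2.
have sw : supported (v^-1 *: u : W) by move=> g s nIg; rewrite scalefunE su // mulr0.
pose D := diagonal (phi c :: t) (v^-1 *: u : W).
have st := diagonal_stabilizes a3 (phi c :: t) sw.
exists (fun x s => extend (phi a3) D s x) => //.
have cD : causal D by move=> g y z yz s; rewrite /D /= yz.
have cx3 b : (a3 <= b)%O -> coherent (phi b) x.
  by rewrite ge_max => /andP[a1b _]; apply: cx; rewrite ltW // (lt_le_trans aa1).
have [_ sfx _] : coherents (fun s => extend (phi a3) D s x).
  by apply: (@extend_coherents _ _ _ a3) => // y g s nIg; rewrite /D /= sw // mulr0.
apply: (@coherent_eq a3) => //.
- by move=> b a3b; apply: extend_coherent; rewrite ?phi_mono //; exact: cx3.
- by move=> b; rewrite ge_max => /andP[_]; exact: cu.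
- move=> b s ba3; rewrite extend_lt ?phi_lt // /D /= scalefunE.
  have [ba1|a1b] := ltP b a1; first by rewrite vu // !mulr0.
  rewrite coherent_head ?phi_lt ?(lt_le_trans ca1) //.
    by rewrite mulrA mulfV ?mul1r //; exact/eqP.
  by apply: cx; rewrite ltW // (lt_le_trans aa1).
Qed.

Definition unit_at c : W := fun s => (s == [:: phi c])%:R.

Lemma unit_at_supported c : supported (unit_at c).
Proof.
move=> g s nIg; rewrite /unit_at eqseq_cons (_ : (g == _) = false) //.
by apply/eqP => gc; apply: nIg; exists c.
Qed.

Lemma prolong_unit_at a c : (c < a)%O -> prolong a (unit_at c) [:: phi c] = 1.
Proof.
move=> ca; have [_ _ ->//] := prolongP a (unit_at_supported c).
by rewrite /unit_at eqxx.
Qed.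

(** The coordinate at [a] is free when coherence is only required from some [b] above [a] on. *)
Lemma tail_strict a : exists2 x, tail a x & x [:: phi a] <> 0.
Proof.
have [b ab] := kappa_unbounded a; exists (prolong b (unit_at a)).
  have [cu _ uE] := prolongP b (unit_at_supported a).
  split=> // c s /= ca; rewrite uE ?(lt_trans ca) // /unit_at eqseq_cons.
  by rewrite -phi_lt in ca; rewrite (lt_eqF ca).
by rewrite prolong_unit_at //; apply/eqP/oner_neq0.
Qed.

Lemma tail_tail_compl a b : (a <= b)%O -> tail a `&` tail_compl a b = tail b.
Proof.
move=> ab; apply/seteqP; split=> [x [[cx va] [_ vab]]|x [cx vb]].
  split=> // c s /= cb; have [ca|ac] := ltP c a; first exact: va.
  by apply: vab; rewrite /= ac.
split; split=> // c s /=; first by move=> ca; apply/vb/(lt_le_trans ca).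
by move=> /andP[_ cb]; exact: vb.
Qed.

(** Keep the coordinates of [x] below [a], put zeros from [a] up to [b], and prolong coherently from
    [b]. *)
Lemma tail_add_compl a b x : (a <= b)%O -> coherents x ->
  exists2 v, tail_compl a b v & tail a (x - v).
Proof.
move=> ab cx.
pose y : W := fun s =>
  if s is g :: _ then if (g < phi a)%O then x s else 0 else 0.
have sy : supported y by case: cx => _ sx _ g s nIg /=; rewrite sx // if_same.
have [cv _ vE] := prolongP b sy.
exists (prolong b y); first split=> // c s /= /andP[ac cb].
  by rewrite vE // /y phi_lt ltNge ac.
split; first have [a0 _] := (submoduleP _).1 (coherents_submodule a).
  have /submoduleP[_ /(_ (-1) _ _ cv cx)] := coherents_submodule a.
  by rewrite scaleN1r addrC.
by move=> c s /= ca; rewrite -[LHS]/(x _ - _) vE ?(lt_le_trans ca) // /y phi_lt ca subrr.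
Qed.

(* [N] below consists of the functions with zero germ at [a]. *)
Lemma germ_endomorphism a : E a -> ~ is_zero a ->
  exists x0, coherents x0 /\ exists f, [/\ stabilizes coherent_family f,
    forall x, supported x -> forall s c, (c < a)%O -> f x (phi c :: s) = 0,
    forall x s, tail a x -> f x (phi a :: s) = 0
    & f x0 [:: phi a] = 1].
Proof.
move=> Ea na0.
have [a' a'a] : exists a', (a' < a)%O.
  apply: contrapT => na'; apply: na0 => b; rewrite leNgt; apply/negP => ba.
  by apply: na'; exists b.
pose N : set W := [set x | exists2 c, (c < a)%O & vanishing [set e | (c <= e < a)%O] x].
have sN : submodule N.
  apply/submoduleP; split=> [|k x y [c ca xc] [e ea ye]]; first by exists a'.
  exists (Order.max c e); first by rewrite gt_max ca ea.
  move=> b s /=; rewrite ge_max => /andP[/andP[cb eb] ba].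
  by rewrite linfunE xc ?ye ?mulr0 ?addr0 //= ?cb ?eb.
(* All coordinates of [y0] over [kappa] are non-zero, so its prolongation [x0] has a non-zero germ
   at [a]. *)
pose y0 : W := fun s => if s is g :: _ then (`[< range phi g >])%:R else 0.
have sy0 : supported y0 by move=> g s nIg; rewrite /y0 asboolF.
have [cx0 _ x0E] := prolongP a sy0; set x0 := prolong a y0 in cx0 x0E.
have Nx0 : ~ N x0.
  move=> [c ca vx0]; have := vx0 c [::]; rewrite /= lexx ca x0E //.
  rewrite /y0 asboolT; last by exists c.
  by move=> /(_ isT)/eqP; rewrite oner_eq0.
have [h [lh hN hx0]] := separating_functional sN Nx0.
pose f x : W := fun s => if s is g :: _ then (g == phi a)%:R * h x else 0.
have fE x c s : (c < a)%O -> f x (phi c :: s) = 0.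
  by rewrite -phi_lt => ca; rewrite /f (lt_eqF ca) mul0r.
have [b ab] := kappa_unbounded a.
exists x0; split=> //; exists (fun x s => extend (phi b) f s x); split.
- apply: extend_stabilizes.
  + move=> k x y; apply/funext => -[|g s]; rewrite linfunE /=; first by rewrite mulr0 addr0.
    by rewrite lh mulrDr mulrCA.
  (* Functions that agree up to [a] differ by an element of [N], which [h] kills. *)
  + move=> g x y xy s; rewrite /f; have [ga|_] := eqVneq g (phi a); last by rewrite !mul0r.
    congr (_ * _); apply/eqP; rewrite -subr_eq0; apply/eqP.
    have -> : h x - h y = h (-1 *: y + x) by rewrite lh mulN1r addrC.
    apply: hN; exists a' => // c t /= /andP[_ ca].
    by rewrite linfunE xy ?mulN1r ?addNr // ga phi_mono ltW.
  + move=> x g s nIg; rewrite /f (_ : (g == _) = false) ?mul0r //.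
    by apply/eqP => ga; apply: nIg; exists a.
  (* Here [a] being in [E] is used: an interval containing [a] whose start [b1] is outside [E]
     starts strictly below [a], so a function vanishing on it has zero germ at [a]. *)
  + move=> b1 b2 nEb1 x _ vx c s /= /andP[b1c cb2].
    rewrite /f; have [/eqP|_] := eqVneq (phi c) (phi a); last by rewrite mul0r.
    rewrite (inj_eq (inc_inj phi_mono)) => /eqP ca; rewrite hN ?mulr0 //.
    rewrite ca in b1c cb2; exists b1.
      by rewrite lt_neqAle b1c andbT; apply/eqP => b1a; apply: nEb1; rewrite b1a.
    by move=> e t /= /andP[b1e ea]; apply: vx; rewrite /= b1e (lt_trans ea).
- by move=> x _ s c ca; rewrite extend_lt ?phi_lt ?(lt_trans ca) //; exact: fE.
- move=> x s [_ vx]; rewrite extend_lt ?phi_lt // /f hN ?mulr0 //.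
  by exists a' => // c t /= /andP[_ ca]; exact: vx.
- by rewrite extend_lt ?phi_lt // /f eqxx hx0 mulr1.
Qed.

(** On functions coherent from [a] on, this map has rank at most one: it reads a single value of [x]
    and multiplies a fixed vector by it. *)
Lemma prolong_unit_diagonal a c t x : (forall b, (a <= b)%O -> coherent (phi b) x) ->
  (c < a)%O ->
  (fun s => extend (phi a) (diagonal t (unit_at c)) s x) =
  x (phi c :: t) *: prolong a (unit_at c).
Proof.
move=> cx ca; have su := unit_at_supported c.
have [[z0 sz _] cz zE] := prolongP a su.
have cD : causal (diagonal t (unit_at c)) by move=> g y y' yy' s /=; rewrite yy'.
have [_ sfx _] : coherents (fun s => extend (phi a) (diagonal t (unit_at c)) s x).
  by apply: (@extend_coherents _ _ _ a) => // y g s nIg /=; rewrite su // mulr0.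
have cz' b : (a <= b)%O -> coherent (phi b) (x (phi c :: t) *: prolong a (unit_at c)).
  move=> ab; rewrite -[_ *: _]addr0; apply: coherent_lin; first exact: cz.
  exact: coherent0.
apply: (@coherent_eq a) => //.
- by rewrite scalefunE z0 mulr0.
- by move=> g s nIg; rewrite scalefunE sz // mulr0.
- by move=> b ab; apply: extend_coherent; rewrite ?phi_mono //; exact: cx.
- move=> b s ba; rewrite extend_lt ?phi_lt // scalefunE zE //= /unit_at eqseq_cons.
  by have [->//|_] := eqVneq (phi b) (phi c); rewrite !mulr0.
Qed.

(** Commuting with the rank-one maps forces [G] to scale the coordinate at each [c] by some [mu c];
    coherence then identifies all these scalars. *)
Lemma commuting_scalar a0 (G : W -> W) :
    (forall x, coherents x -> coherents (G x)) ->
    (forall k x, coherents x -> G (k *: x) = k *: G x) ->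
    (forall f, stabilizes coherent_family f -> forall x, coherents x -> G (f x) = f (G x)) ->
  exists mu : F, forall x, coherents x -> G x = mu *: x.
Proof.
move=> GC GZ Gf; pose z b c := prolong b (unit_at c).
have Cz b c : coherents (z b c) by have [] := prolongP b (unit_at_supported c).
have z1 b c : (c < b)%O -> z b c [:: phi c] = 1 by exact: prolong_unit_at.
have coh2 x : coherents x -> exists a, forall b, (a <= b)%O ->
    coherent (phi b) x /\ coherent (phi b) (G x).
  move=> Cx; have [_ _ [a1 cx]] := Cx; have [_ _ [a2 cGx]] := GC x Cx.
  exists (Order.max a1 a2) => b; rewrite ge_max => /andP[a1b a2b].
  by split; [exact: cx|exact: cGx].
have stepA x c t : coherents x -> exists a, forall b, (a <= b)%O ->
    x (phi c :: t) *: G (z b c) = G x (phi c :: t) *: z b c.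
  move=> Cx; have [a cohx] := coh2 x Cx; have [a' a'P] := kappa_unbounded (Order.max a c).
  move: a'P; rewrite gt_max => /andP[aa' ca']; exists a' => b a'b.
  have cb := lt_le_trans ca' a'b.
  have cohb (e : kappa) : (b <= e)%O -> coherent (phi e) x /\ coherent (phi e) (G x).
    by move=> be; apply: cohx; apply: le_trans be; rewrite ltW // (lt_le_trans aa').
  rewrite -GZ // -(prolong_unit_diagonal t (fun b' bb' => (cohb b' bb').1) cb).
  rewrite -(prolong_unit_diagonal t (fun b' bb' => (cohb b' bb').2) cb).
  apply: (Gf (fun x s => extend (phi b) (diagonal t (unit_at c)) s x)) => //.
  exact/diagonal_stabilizes/unit_at_supported.
(* The vector [z e c] has value 1 at [[:: phi c]]. For large [e], comparing [stepA] for [z b c] and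
   for [x] at this sequence gives the scalar. *)
have stepB c :
    exists mu : F, forall x t, coherents x -> G x (phi c :: t) = mu * x (phi c :: t).
  have [b cb] := kappa_unbounded c; exists (G (z b c) [:: phi c]) => x t Cx.
  have [a1 H1] := stepA _ c [::] (Cz b c); have [a2 H2] := stepA _ c t Cx.
  have [e eP] := kappa_unbounded (Order.max c (Order.max a1 a2)).
  move: eP; rewrite !gt_max => /and3P[ce /ltW/H1 H1e /ltW/H2].
  rewrite z1 // scale1r in H1e.
  rewrite H1e => /(congr1 (fun y : W => y [:: phi c])).
  by rewrite !scalefunE z1 // !mulr1 mulrC.
have /choice[mu muP] := stepB.
(* Coherence of [z b c] and its image at a late [e] copies their values at [[:: phi c]] into the
   coordinate at [e], which [G] scales by [mu e]. *)
have stepD c : exists b, forall e : kappa, (b <= e)%O -> mu c = mu e.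
  have [b cb] := kappa_unbounded c; have [b' cohz] := coh2 _ (Cz b c).
  have [b'' b''P] := kappa_unbounded (Order.max c b').
  move: b''P; rewrite gt_max => /andP[cb'' b'b'']; exists b'' => e b''e.
  have [cz cGz] := cohz e (ltW (lt_le_trans b'b'' b''e)).
  have ce : (phi c < phi e)%O by rewrite phi_lt (lt_le_trans cb'').
  have := coherent_head [::] cGz ce; rewrite !muP //.
  by rewrite (coherent_head [::] cz ce) z1 // !mulr1.
exists (mu a0) => x Cx; have [x0 sx _] := Cx; have [Gx0 sGx _] := GC x Cx.
apply/funext => -[|g s]; rewrite scalefunE; first by rewrite x0 Gx0 mulr0.
have [[c _ <-]|nIg] := pselect (range phi g); last by rewrite sx // sGx // mulr0.
rewrite muP //; congr (_ * _); have [b1 H1] := stepD c; have [b2 H2] := stepD a0.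
by rewrite (H1 (Order.max b1 b2)) ?(H2 (Order.max b1 b2)) // le_max lexx ?orbT.
Qed.

End CoherentFunctions.

(** * The module of coherent functions *)

Section CoherentModule.
Context {F : fieldType} {d : Order.disp_t} {lambda : orderType d}.
Context {d' : Order.disp_t} {kappa : orderType d'} (phi : kappa -> lambda).
Context (phi_mono : {mono phi : a b / (a <= b)%O}).
Context (kappa_regular : regular_uncountable kappa).
Context (E : set kappa) {nzW : exists w : seq lambda -> F^o, w != 0}.

Notation W := (seq lambda -> F^o).
Let C : set W := coherents phi.
Let p : set (set W) := coherent_family phi E.

Let pC : p C. Proof. exact: Or31. Qed.

Let sC : submodule C.
Proof. by have [a _] := regular_nonempty kappa_regular; exact: coherents_submodule a. Qed.

Let unbounded_kappa := regular_unbounded kappa_regular.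

Notation M := (stab_module nzW pC sC).

Let woK : is_ordinal kappa. Proof. by case: kappa_regular => -[[]]. Qed.

Let act f : stabilizes p f ->
  exists r : (stab_algebra nzW)^c, forall x : M, stab_val (r *: x) = f (stab_val x).
Proof.
by move=> /(exists_stab (nzW := nzW))[r rf]; exists r => x; rewrite stab_val_act rf.
Qed.

Let lift x : C x -> exists m : M, stab_val m = x.
Proof. by move=> Cx; exists (StabModule nzW pC sC (mem_set Cx)). Qed.

Definition module_tail (a : kappa) : set M := [set x : M | tail phi a (stab_val x)].

Lemma module_tail_submodule a : submodule (module_tail a).
Proof.
apply: (@stab_submodule _ _ nzW p C pC sC (tail phi a)); first by apply: Or32; exists a.
exact: submoduleI sC (vanishing_submodule _ _).
Qed.

Lemma module_tail_cdc : is_cdc module_tail.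
Proof.
split=> [a||a [na0 lima]|a b [ab _]|V [/submoduleP[V0 sV] nV]].
- split; first exact: module_tail_submodule.
  have [x tx nx] := tail_strict (F := F) phi_mono unbounded_kappa a.
  have [m mx] := lift tx.1; move=> /seteqP[+ _] => /(_ m) m0.
  by apply: nx; rewrite -mx m0 //= /module_tail /= mx.
- have [a a0] := well_order_zero woK (regular_nonempty kappa_regular); exists a => //.
  apply/seteqP; split=> // x _; split; first exact: stab_valP.
  by move=> c s /=; rewrite ltNge a0.
- apply/seteqP; split=> [x [cx vx] b ba|x vx].
    by split=> // c s /= cb; apply: vx; exact: lt_trans ba.
  split; first exact: stab_valP.
  by move=> c s /= /lima[b /andP[cb ba]]; have [_] := vx b ba; apply.
- split=> [x [cx vx]|/(_ _ _)sub].
    by split=> // c s /= ca; apply: vx; exact: lt_trans ab.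
  have [x tx nx] := tail_strict (F := F) phi_mono unbounded_kappa a.
  have [m mx] := lift tx.1; apply: nx; rewrite -mx.
  by have [|_] := sub m; [rewrite /module_tail /= mx|apply].
- have [m Vm nm] : exists2 m, V m & m <> 0.
    apply: contrapT => nm; apply: nV; apply/seteqP; split=> [m Vm|_ ->//].
    by apply: contrapT => m0; apply: nm; exists m.
  have [|a aP] := tail_attained phi_mono E unbounded_kappa (stab_valP m).
    by move=> m0; apply: nm; exact: stab_val_inj.
  exists a => u /aP[f /act[r rf] fm].
  rewrite -[u](_ : r *: m = u); last by apply: stab_val_inj; rewrite rf.
  by rewrite -[_ *: _]addr0; exact: sV.
Qed.

Lemma coherent_module_End : @End_eq_scalars F (stab_algebra nzW) M.
Proof.
move=> f; split=> [lf|[c fE]]; last first.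
  move=> r x y; rewrite !fE; apply: stab_val_inj.
  have [lr _] := stab_funP (r : stab_algebra nzW) p.
  change (c *: ((r : stab_algebra nzW) p (stab_val x) + stab_val y) =
    (r : stab_algebra nzW) p (c *: stab_val x) + c *: stab_val y).
  rewrite scalerDr; congr (_ + _).
  by have := lr c (stab_val x) 0; rewrite (linear_fun0 lr) !addr0.
(* [G] is [f] carried over to the ambient space, with default value 0 outside the coherent
   functions. *)
pose G (x : W) : W := if pselect (C x) is left Cx
  then stab_val (f (StabModule nzW pC sC (mem_set Cx))) else 0.
have GE (m : M) : G (stab_val m) = stab_val (f m).
  rewrite /G; case: pselect => [h|[]]; last exact: stab_valP.
  by congr (stab_val (f _)); exact: stab_val_inj.
have fact (r : (stab_algebra nzW)^c) (m : M) : f (r *: m) = r *: f m.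
  by have := lf r m 0; rewrite (linear_fun0 lf) !addr0.
have [a _] := regular_nonempty kappa_regular.
have [|k x Cx|h sh x Cx|mu muP] :=
  commuting_scalar phi_mono unbounded_kappa (E := E) a (G := G).
- by move=> x /lift[m <-]; rewrite GE; exact: stab_valP.
- have [m <-] := lift Cx.
  by rewrite -(stab_val_scalar k m) !GE fact stab_val_scalar.
- have [m <-] := lift Cx; have [r rh] := act sh.
  by rewrite -rh !GE fact rh.
exists mu => m; apply: stab_val_inj; rewrite stab_val_scalar -GE muP //.
exact: stab_valP.
Qed.

Lemma non_complemented_module_tail :
  non_complemented module_tail = E `&` [set a | ~ is_zero a].
Proof.
apply/seteqP; split=> [a [b [ab nc]]|a [Ea na0]].
  split=> [|a0]; apply: contrapT => nE; apply: nc.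
    exists [set x : M | tail_compl phi a b (stab_val x)]; split.
    - apply: (@stab_submodule _ _ nzW p C pC sC (tail_compl phi a b)).
        by apply: Or33; exists a, b.
      exact: submoduleI sC (vanishing_submodule _ _).
    - apply/seteqP; rewrite /module_tail -(tail_tail_compl (F := F) phi (ltW ab)).
      by split.
    - apply/seteqP; split=> // m _.
      have [v vab tv] := tail_add_compl phi_mono (ltW ab) (stab_valP m).
      have [m1 m1E] := lift tv.1; have [m2 m2E] := lift vab.1.
      exists m1; first by rewrite /module_tail /= m1E.
      exists m2; first by rewrite /= m2E.
      by apply: stab_val_inj; rewrite -[LHS]/(stab_val m1 + stab_val m2) m1E m2E subrK.
  (* At zero the tail is the whole module, so [module_tail b] itself is the complement. *)
  have Ta : module_tail a = setT.
    apply/seteqP; split=> // m _; split; first exact: stab_valP.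
    by move=> c s /=; rewrite ltNge a0.
  exists (module_tail b); split; first exact: module_tail_submodule.
    by rewrite Ta meetEset setTI.
  rewrite Ta; apply/seteqP; split=> // m _; exists m => //; exists 0; last by rewrite addr0.
  by have /submoduleP[] := module_tail_submodule b.
have [b ab] := unbounded_kappa a; exists b; split=> // -[X [/submoduleP[X0 sX] XT XU]].
have [x0 [Cx0 [f [sf f1 f2 f3]]]] :=
  germ_endomorphism (F := F) phi_mono unbounded_kappa Ea na0.
have [m mx0] := lift Cx0; have [r rf] := act sf.
(* Split [x0] as [u + x] along the supposed complement. Then [r *: x] vanishes below [a] and lies in
   [X], hence in the tail at [b]. But its coordinate at [a] is non-zero: [f] sends [x0] to a
   function with value 1 there, while [u] contributes 0. *)
have : [set w + x | w in module_tail a & x in X] m by rewrite XU.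
move=> [u tu [x Xx uxm]].
have Xrx : X (r *: x) by rewrite -[_ *: _]addr0; exact: sX.
have : (module_tail a `&` X) (r *: x).
  split=> //; split; first exact: stab_valP.
  move=> c s ca; rewrite rf; apply: f1 => //.
  by have [] := stab_valP x.
rewrite -meetEset XT => -[_ /(_ a [::] ab)] /eqP; rewrite rf; apply/negP.
have -> : stab_val x = -1 *: stab_val u + x0.
  by rewrite -mx0 -uxm -[X in _ = _ + X]/(stab_val u + stab_val x) scaleN1r addKr.
have [lf _] := sf; rewrite lf linfunE f2 // mulr0 add0r f3.
exact: oner_neq0.
Qed.

End CoherentModule.

(** Absorbs the exception at zero in [non_complemented_module_tail]: the non-zero elements form a
    club. *)
Lemma club_class_nonzero (d : Order.disp_t) (K : orderType d) (E : set K) :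
  regular_uncountable K -> club_class (E `&` [set a | ~ is_zero a]) = club_class E.
Proof.
move=> regK; apply: (club_class_eq regK (club_nonzero regK)).
by rewrite -setIA setIid.
Qed.

Theorem theorem2p7 (d : Order.disp_t) (lambda : orderType d) (F : fieldType)
    (lambda_unc : uncountable_cardinal lambda) :
  exists R : algType F,
    (forall (d' : Order.disp_t) (kappa : orderType d'),
       regular_uncountable kappa -> ordinal_le kappa lambda ->
       forall i : set (set kappa), Bclub kappa i ->
       exists L : lmodType R^c,
         [/\ strongly_uniform L, has_dimension L kappa,
             End_eq_scalars L & Gamma L kappa = i]) /\
    (forall (d' : Order.disp_t) (kappa : orderType d'),
       regular_uncountable kappa -> ordinal_le kappa lambda ->
       full_spectrum R kappa).
Proof.
have nzW : exists w : seq lambda -> F^o, w != 0.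
  exists (fun _ => 1); apply/eqP => /(congr1 (fun w => w [::]))/eqP; exact/negP/oner_neq0.
exists (stab_algebra nzW).
set R : algType F := stab_algebra nzW.
have realized d' (kappa : orderType d') : regular_uncountable kappa ->
    ordinal_le kappa lambda -> forall i, Bclub kappa i ->
    exists L : lmodType R^c, [/\ strongly_uniform L, has_dimension L kappa,
      End_eq_scalars L & Gamma L kappa = i].
  (* For a representative [E] of the class, the component of the algebra at [coherent_family phi E]
     acts on the coherent functions. *)
  move=> regK [phi [phi_mono _]] _ [E _ <-].
  have Ucdc := module_tail_cdc phi_mono regK E (nzW := nzW).
  eexists; split.
  - by exists d', kappa; split; [case: (regK) => -[[]]|eexists; exact: Ucdc].
  - exact: (cdc_has_dimension regK Ucdc).
  - exact: coherent_module_End.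
  - by rewrite (Gamma_cdc regK Ucdc) non_complemented_module_tail // club_class_nonzero.
split=> // d' kappa regK leK; apply/seteqP; split=> [i []//|i Bi].
split=> //; have [L [suL dimL _ GL]] := realized d' kappa regK leK i Bi.
by exists L.
Qed.
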